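(* Let $X$ be a locally compact Hausdorff space with countable base and let $G\colon X\times X\to[0,\infty]$ be a Borel measurable function with $G>0$ satisfying (1) and (2) of the context. Let $P$ be an $F_\sigma$-set in $X$, $P=\bigcup_{m\in\mathbb N}A_m$ with closed sets $A_m\subset X$. Then $c^\ast(P)=0$ if and only if there is a measure $\mu\in\mathcal M(P)$ with $G\mu=\infty$ on $P$.
   Context: Assumptions on $G$: (1) For every $x\in X$, $\lim_{y\to x}G(x,y)=G(x,x)=\infty$, and $G(x,\cdot)$ is bounded outside every neighborhood of $x$. (2) $G$ has the local triangle property: every point of $X$ admits an open neighborhood $U$ such that the restriction $G|_{U\times U}$ has the triangle property, that is, there is $C>0$ (depending on $U$) with $\min\{G(x,z),G(y,z)\}\le C\,G(x,y)$ for all $x,y,z\in U$. For a Borel set $B\subset X$, $\mathcal M(B)$ denotes the set of all finite positive Radon measures $\mu$ on $X$ with $\mu(X\setminus B)=0$, and $\|\mu\|$ denotes the total mass of $\mu$. For $\mu\in\mathcal M(X)$ and $x\in X$, $G\mu(x):=\int G(x,y)\,d\mu(y)$. For $A\subset X$, $c^\ast(A):=\inf\{\|\mu\|:\mu\in\mathcal M(X),\ G\mu\ge 1\text{ on }A\}$ (with $\inf\emptyset=\infty$). *)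

(* Defs.v *)
From HB Require Import structures.
From mathcomp Require Import all_boot all_order all_algebra.
From mathcomp Require Import all_classical all_reals all_analysis.
From mathcomp Require Import measurable_realfun.

Set Implicit Arguments.
Unset Strict Implicit.
Unset Printing Implicit Defensive.

Import Order.TTheory GRing.Theory Num.Theory.
Import numFieldNormedType.Exports.

Local Open Scope classical_set_scope.
Local Open Scope ring_scope.
Local Open Scope ereal_scope.

(* X with its Borel sigma-algebra; [borel (X * X)%type] uses the open sets of
   the product topology. *)
Notation borel X := (g_sigma_algebraType (@open X)).

Section kernel.
Context {R : realType} {X : ptopologicalType}.
Implicit Types (G : X * X -> \bar R) (mu : {measure set (borel X) -> \bar R}).

Definition borel_kernel G : Prop :=
  measurable_fun [set: borel (X * X)%type] (G : borel (X * X)%type -> \bar R).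

(* The limit is taken over y <> x; the value at y = x is given separately. *)
Definition singular_on_diagonal G : Prop :=
  forall x, [/\ G (x, y) @[y --> x^'] --> +oo, G (x, x) = +oo &
    forall V, nbhs x V ->
      exists M : R, forall y, ~ V y -> G (x, y) <= M%:E].

Definition triangle_property_on G (U : set X) : Prop :=
  exists C : R, (0 < C)%R /\
    forall x y z, U x -> U y -> U z ->
      mine (G (x, z)) (G (y, z)) <= C%:E * G (x, y).

Definition local_triangle_property G : Prop :=
  forall x, exists U : set X, [/\ open U, U x & triangle_property_on G U].

Definition radon mu : Prop :=
  (forall K : set X, compact K -> mu K < +oo) /\
  (forall B : set (borel X), measurable B ->
    mu B = ereal_sup [set mu K | K in [set K : set X | compact K /\ K `<=` B]]).

(* The set M(B), intended for Borel sets B. *)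
Definition finite_radon_on (B : set X) : set {measure set (borel X) -> \bar R} :=
  [set mu : {measure set (borel X) -> \bar R} |
    [/\ mu setT < +oo, radon mu & mu (~` B) = 0]].

Definition potential G mu (x : X) : \bar R := \int[mu]_y G (x, y).

Definition c_star G (A : set X) : \bar R :=
  ereal_inf [set mu setT | mu in
    [set mu : {measure set (borel X) -> \bar R} |
      finite_radon_on setT mu /\ forall x, A x -> 1 <= potential G mu x]].

End kernel.

(* Main.v *)
Require Import Defs.
From HB Require Import structures.
From mathcomp Require Import all_boot all_order all_algebra.
From mathcomp Require Import all_classical all_reals all_analysis.
From mathcomp Require Import measurable_realfun.

Local Open Scope classical_set_scope.
Local Open Scope ring_scope.
Local Open Scope ereal_scope.

Set Implicit Arguments.
Unset Strict Implicit.
Unset Printing Implicit Defensive.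

Import Order.TTheory GRing.Theory Num.Theory.

(** If the potential of [mu] is infinite on [P], then so is that of every
    positive multiple of [mu], and these have arbitrarily small mass: this gives
    [c_star G P = 0].

    Conversely, [c_star G P = 0] provides measures of mass at most
    [1 / 2 ^ n.+1] whose potentials are at least 1 on [P]; their sum [nu] is a
    finite measure with infinite potential on [P]
    ([c_star0_infinite_potential]). It may charge the complement of [P], and the
    point is to sweep it onto [P]. The triangle property says that [1 / G] is
    locally a quasi-metric, for which [G (x, z)] large means [x] close to [z].
    Let [A] be one of the closed sets, and let [U] be an open set on which the
    triangle property holds. Move each [z] in [U] outside [A] to a point [T z]
    of [A] in [U] that is nearly closest to [z], and leave the points of [A] in
    [U] in place. Seen from a point [x] of [A] in [U], the nearly closest point
    [T z] is not much further away than [z], so that [G (x, z)] is at most a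
    constant times [G (x, T z)] ([sweeping_map]). What [nu] has outside [U]
    contributes only a finite amount to the potential at [x], because [G (x, _)]
    is bounded there. Hence the image of [nu] under [T] still has infinite
    potential on the part of [A] in [U], and it is carried by [A]
    ([infinite_potential_sweep]). Since the topology has a countable base,
    countably many such pieces cover [P], and a suitably weighted sum of the
    corresponding measures is carried by [P] and has infinite potential on [P]
    ([infinite_potential_on_bigcup]).

    All measures constructed here are Radon because on a locally compact
    Hausdorff space with countable base every finite Borel measure is
    ([finite_borel_radon]). *)

(** * Borel sets and countable bases *)

Lemma open_borel (X : ptopologicalType) (U : set X) :
  open U -> measurable (U : set (borel X)).
Proof. by move=> oU; apply: sub_sigma_algebra. Qed.

Lemma closed_borel (X : ptopologicalType) (A : set X) :
  closed A -> measurable (A : set (borel X)).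
Proof.
move=> cA; rewrite -(setCK A); apply: (@measurableC _ (borel X)).
by apply: open_borel; exact: closed_openC.
Qed.

Lemma base_sequence (X : ptopologicalType) : @second_countable X ->
  exists b : nat -> set X, (forall n, open (b n)) /\
    forall x V, nbhs x V -> exists n, b n x /\ b n `<=` V.
Proof.
case=> B /pfcard_geP[B0 | /unsquash f] [oB nB].
  by have [V [/=]] := nB point _ (@filterT _ (nbhs point) _); rewrite B0.
exists f; split=> [n|x V /nB [W [BW Wx] WV]].
  by apply: oB; exact: funS.
by have [n _ fn] := @surj _ _ _ _ f W BW; exists n; rewrite fn.
Qed.

(** * Finite Borel measures are Radon *)

Section radon.
Context {R : realType} {X : ptopologicalType}.
Hypotheses (X_lc : locally_compact [set: X]) (X_hausdorff : hausdorff_space X)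
  (X_sc : @second_countable X).

Let compact_borel (K : set X) : compact K -> measurable (K : set (borel X)).
Proof. by move=> cK; apply: closed_borel; exact: compact_closed. Qed.

(** By regularity, an open set is the union of the basic open sets whose
    closure is compact and contained in it. *)
Lemma open_sigma_compact (U : set X) : open U ->
  exists K : nat -> set X, (forall n, compact (K n)) /\ U = \bigcup_n K n.
Proof.
move=> oU; have [b [ob bV]] := base_sequence X_sc.
pose K n := if pselect (compact (closure (b n)) /\ closure (b n) `<=` U)
  then closure (b n) else set0.
exists K; split=> [n|].
  by rewrite /K; case: pselect => [[]|?] //=; exact: compact0.
rewrite eqEsubset; split=> [x Ux|x [n _]]; last first.
  by rewrite /K; case: pselect => [[? bU]|? []] /= /bU.
have [C nC [cC clC]] := X_lc (I : [set: X] x).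
have {}nC : nbhs x C.
  by have := nC : nbhs x (fun y => True -> C y); apply: filterS => y; exact.
have [V nV VU] := compact_regular X_hausdorff cC nC (open_nbhs_nbhs (conj oU Ux)).
have [n [bx bVC]] := bV x (V `&` C) (filterI nV nC).
exists n => //; rewrite /K; case: pselect => [?|[]] /=; first exact: subset_closure.
split.
  apply: (subclosed_compact _ cC); first exact: closed_closure.
  by rewrite ((closure_id C).1 clC); apply: closureS => y /bVC [].
by apply: subset_trans VU; apply: closureS => y /bVC [].
Qed.

Variable mu : {measure set (borel X) -> \bar R}.
Hypothesis mu_fin : mu setT < +oo.

Let mu_le (B C : set (borel X)) :
  measurable B -> measurable C -> B `<=` C -> mu B <= mu C.
Proof. by move=> mB mC; apply: le_measure; rewrite inE. Qed.

Let mu_lty (B : set (borel X)) : measurable B -> mu B < +oo.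
Proof.
by move=> mB; apply: le_lt_trans mu_fin; apply: mu_le => //; exact: measurableT.
Qed.

Definition tight (B : set X) := forall e : R, (0 < e)%R ->
  exists K : set X, [/\ compact K, K `<=` B & mu (B `\` K) < e%:E].

(** Compact subsets of the [B n] with geometrically small losses exhaust the
    union up to a small set; finitely many of them suffice by continuity from
    above, since [mu] is finite. *)
Lemma tight_bigcup (B : nat -> set X) :
  (forall n, measurable (B n : set (borel X))) -> (forall n, tight (B n)) ->
  tight (\bigcup_n B n).
Proof.
move=> mB tB e e0.
have /choice [K KP] : forall n, exists K : set X, [/\ compact K, K `<=` B n &
    mu (B n `\` K) < (e / 2 / (2 ^ n.+1)%:R)%:E].
  by move=> n; apply: tB; rewrite !divr_gt0// ltr0n expn_gt0.
have mK n : measurable (K n : set (borel X)).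
  by apply: compact_borel; case: (KP n).
pose F N := \bigcup_n B n `\` \big[setU/set0]_(i < N) K i.
have mF N : measurable (F N : set (borel X)).
  by apply: measurableD; [exact: bigcup_measurable|exact: bigsetU_measurable].
have FE : \bigcap_n F n = \bigcup_n B n `\` \bigcup_n K n.
  rewrite eqEsubset; split=> [x FBx|x [Bx nK] N _].
    split; first by have [] := FBx 0%N I.
    move=> [n _ Kx]; have [_] := FBx n.+1 I; apply.
    by rewrite big_ord_recr/=; right.
  split=> // Kx; apply: nK; move: Kx; rewrite -bigcup_mkord => -[n _ Kx].
  by exists n.
have mFI : measurable (\bigcap_n F n : set (borel X)) by exact: bigcap_measurable.
have F_small : mu (\bigcap_n F n) < e%:E.
  have le2 : mu (\bigcap_n F n) <= (e / 2)%:E.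
    apply: le_trans (epsilon_trick0 xpredT _); last by rewrite divr_ge0// ltW.
    apply: (le_trans (measure_sigma_subadditive mu
      (F := fun n => B n `\` K n) _ mFI _)).
    - by move=> n; exact: measurableD.
    - rewrite FE => x [[n _ Bx] nK]; exists n => //; split=> // Kx.
      by apply: nK; exists n.
    - by apply: lee_nneseries => // n _; have [_ _ /ltW] := KP n.
  by apply: le_lt_trans le2 _; rewrite lte_fin ltr_pdivrMr// ltr_pMr// ltr1n.
have : (mu \o F) N @[N --> \oo] --> mu (\bigcap_n F n).
  apply: nonincreasing_cvg_mu => //.
    exact: mu_lty.
  move=> n m nm; apply/subsetPset; apply: setDS; exact: subset_bigsetU.
move=> /(_ [set y | y < e%:E]) []; first exact: open_ereal_lt'.
move=> N _ /(_ N (leqnn N)) /= FN; exists (\big[setU/set0]_(i < N) K i); split=> //.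
  by apply: bigsetU_compact => i _; case: (KP i).
rewrite -bigcup_mkord => x [n _ Kx]; exists n => //.
by have [_ + _] := KP n; apply.
Qed.

Lemma tight_compact (K : set X) : compact K -> tight K.
Proof.
by move=> cK e e0; exists K; split=> //; rewrite setDv measure0 lte_fin.
Qed.

Lemma tight_sigma_compact (K : nat -> set X) :
  (forall n, compact (K n)) -> tight (\bigcup_n K n).
Proof.
move=> cK; apply: tight_bigcup => n; first exact: compact_borel.
exact: tight_compact.
Qed.

Lemma tight_bigcap (B : nat -> set X) :
  (forall n, measurable (B n : set (borel X))) -> (forall n, tight (B n)) ->
  tight (\bigcap_n B n).
Proof.
move=> mB tB e e0.
have /choice [K KP] : forall n, exists K : set X, [/\ compact K, K `<=` B n &
    mu (B n `\` K) < (e / 2 / (2 ^ n.+1)%:R)%:E].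
  by move=> n; apply: tB; rewrite !divr_gt0// ltr0n expn_gt0.
have cK n : compact (K n) by case: (KP n).
have mK n : measurable (K n : set (borel X)) by exact: compact_borel.
exists (\bigcap_n K n); split.
- apply: (subclosed_compact _ (cK 0%N)); last exact: bigcap_inf.
  by apply: closed_bigI => n _; exact: compact_closed.
- by move=> x Kx n _; have [_ + _] := KP n; apply; exact: Kx.
- have le2 : mu (\bigcap_n B n `\` \bigcap_n K n) <= (e / 2)%:E.
    apply: le_trans (epsilon_trick0 xpredT _); last by rewrite divr_ge0// ltW.
    apply: (le_trans (measure_sigma_subadditive mu
      (F := fun n => B n `\` K n) _ _ _)).
    + by move=> n; exact: measurableD.
    + by apply: measurableD; exact: bigcapT_measurable.
    + move=> x [Bx nK]; apply: contrapT => nBK; apply: nK => n _.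
      apply: contrapT => nKx; apply: nBK; exists n => //; split=> //; exact: Bx.
    + by apply: lee_nneseries => // n _; have [_ _ /ltW] := KP n.
  by apply: le_lt_trans le2 _; rewrite lte_fin ltr_pdivrMr// ltr_pMr// ltr1n.
Qed.

Lemma tight_open (U : set X) : open U -> tight U.
Proof.
by move=> /open_sigma_compact [K [cK ->]]; exact: tight_sigma_compact.
Qed.

Lemma tight_closed (A : set X) : closed A -> tight A.
Proof.
move=> cA; have [K [cK KT]] := open_sigma_compact openT.
rewrite -(setTI A) KT setI_bigcupl; apply: tight_sigma_compact => n.
exact: compact_closedI.
Qed.

(** Tightness is not visibly stable under complement, but it is stable under
    countable unions and intersections; so the sets that are tight together with
    their complements form a sigma-algebra, and it contains the open sets. *)
Lemma tight_borel (B : set X) : measurable (B : set (borel X)) -> tight B.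
Proof.
pose T := [set B : set X | [/\ measurable (B : set (borel X)), tight B &
  tight (~` B)]].
suff sT : <<s @open X>> `<=` T by move=> /sT [].
apply: smallest_sub; last first.
  move=> U oU; split; first exact: open_borel; first exact: tight_open.
  by apply: tight_closed; exact: open_closedC.
split.
- split; first exact: measurable0.
    by apply: tight_compact; exact: compact0.
  by rewrite setC0; apply: tight_open; exact: openT.
- move=> C [mC tC tC']; rewrite setTD; split=> //; last by rewrite setCK.
  exact: (@measurableC _ (borel X)).
- move=> C TC; split.
  + by apply: (@bigcup_measurable _ (borel X)) => n _; case: (TC n).
  + by apply: tight_bigcup => n; case: (TC n).
  + rewrite setC_bigcup; apply: tight_bigcap => n; case: (TC n) => //.
    by move=> mC _ _; exact: (@measurableC _ (borel X)).
Qed.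

Lemma finite_borel_radon : radon mu.
Proof.
split=> [K cK|B mB]; first by apply: mu_lty; exact: compact_borel.
apply/eqP; rewrite eq_le; apply/andP; split; last first.
  apply: ge_ereal_sup => _ [K [cK KB] <-]; apply: mu_le => //.
  exact: compact_borel.
apply/lee_addgt0Pr => e e0; have [K [cK KB BK]] := tight_borel mB e0.
have mK := compact_borel cK.
have -> : mu B = mu K + mu (B `\` K).
  by rewrite -measureU ?setDUK//; [exact: measurableD|rewrite setDIK].
apply: leeD; last exact: ltW.
by apply: ereal_sup_ubound; exists K.
Qed.
End radon.

(** * Measures whose potential is infinite on a set *)

Section potentials.
Context {R : realType} {X : ptopologicalType} (G : X * X -> \bar R).
Hypotheses (G_borel : borel_kernel G) (G_gt0 : forall x y : X, 0 < G (x, y)).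

Let G_ge0 (x y : X) : 0 <= G (x, y). Proof. exact: ltW. Qed.

Lemma measurable_section (x : X) :
  measurable_fun [set: borel X] (fun y : borel X => G (x, y)).
Proof.
have cx : continuous (fun y : X => (x, y)).
  by move=> y; apply: cvg_pair => //=; exact: cvg_cst.
have mcx : measurable_fun [set: borel X]
    ((fun y => (x, y)) : borel X -> borel (X * X)%type).
  have := @measurability _ _ (borel X) (borel (X * X)%type) setT (pair x)
    (@open (X * X)%type).
  apply=> // _ [U oU <-]; rewrite setTI; apply: open_borel.
  by move/continuousP : cx; exact.
have := measurableT_comp G_borel mcx.
exact.
Qed.

Lemma potential_series (mu : nat -> {measure set (borel X) -> \bar R}) (x : X) :
  potential G (mseries mu 0) x = \sum_(n <oo) potential G (mu n) x.
Proof.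
by rewrite /potential ge0_integral_measure_series//; exact: measurable_section.
Qed.

Lemma potential_scale (c : {nonneg R}) (mu : {measure set (borel X) -> \bar R})
    (x : X) :
  potential G (mscale c mu) x = c%:num%:E * potential G mu x.
Proof.
by rewrite /potential ge0_integral_mscale//; exact: measurable_section.
Qed.

(** Radonness is left out because finite Borel measures on the spaces of
    interest have it automatically; sums and images are then easier to form. *)
Definition infinite_potential_on (P Q : set X) : Prop :=
  exists mu : {measure set (borel X) -> \bar R},
    [/\ mu setT < +oo, mu (~` P) = 0 &
        forall x, Q x -> potential G mu x = +oo].

(** The weight [1 / 2 ^ n.+1 / (1 + r n)] keeps the total mass at most 1, and
    being positive it preserves infinite potentials. *)
Lemma infinite_potential_on_bigcup (P : set X) (Q : nat -> set X) :
  (forall n, infinite_potential_on P (Q n)) ->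
  infinite_potential_on P (\bigcup_n Q n).
Proof.
move=> /choice[mu muP].
pose r n := fine (mu n setT).
have r0 n : (0 <= r n)%R by apply: fine_ge0.
have c0 n : (0 <= 1 / (2 ^ n.+1)%:R / (1 + r n))%R.
  by rewrite !divr_ge0// addr_ge0.
pose nu n : {measure set (borel X) -> \bar R} := mscale (NngNum (c0 n)) (mu n).
exists (mseries nu 0); split.
- apply: (@le_lt_trans _ _ 1%:E); last exact: ltry.
  apply: le_trans (@epsilon_trick0 R 1 xpredT _); last by [].
  apply: lee_nneseries => // n _.
  have -> : nu n setT = (1 / (2 ^ n.+1)%:R / (1 + r n))%:E * mu n setT by [].
  have -> : mu n setT = (r n)%:E.
    by rewrite fineK// ge0_fin_numE//; case: (muP n).
  rewrite -EFinM lee_fin [leLHS]mulrAC ler_pdivrMr; last by rewrite ltr_wpDr.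
  by rewrite ler_wpM2l ?divr_ge0// lerDr.
- apply: eseries0 => n _ _.
  have -> : nu n (~` P) = (1 / (2 ^ n.+1)%:R / (1 + r n))%:E * mu n (~` P) by [].
  by have [_ -> _] := muP n; rewrite mule0.
- move=> x [n _ Qx]; rewrite potential_series.
  apply/eqP; rewrite -leye_eq.
  have p0 i : 0 <= potential G (nu i) x by apply: integral_ge0.
  apply: le_trans (nneseries_lim_ge n.+1 _); last by [].
  rewrite big_mkord big_ord_recr/= potential_scale/=.
  have [_ _ ->//] := muP n.
  rewrite gt0_muley; last by rewrite lte_fin !divr_gt0// ltr_wpDr.
  by rewrite addey// -ltNye (@lt_le_trans _ _ 0)// sume_ge0.
Qed.

(** Sum competitors for the infimum of mass at most [1 / 2 ^ n.+1]: each of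
    them contributes at least 1 to the potential on [P]. *)
Lemma c_star0_infinite_potential (P : set X) :
  c_star G P = 0 -> infinite_potential_on setT P.
Proof.
move=> cP.
have /choice[nu nuP] : forall n, exists nu : {measure set (borel X) -> \bar R},
    nu setT <= (1 / (2 ^ n.+1)%:R)%:E /\
    forall x, P x -> 1 <= potential G nu x.
  move=> n; have : c_star G P < (1 / (2 ^ n.+1)%:R)%:E.
    by rewrite cP lte_fin divr_gt0.
  by move=> /ereal_inf_lt[_ [nu [_ nu1] <-] /ltW lenu]; exists nu.
exists (mseries nu 0); split.
- apply: (@le_lt_trans _ _ 1%:E); last exact: ltry.
  apply: le_trans (@epsilon_trick0 R 1 xpredT _); last by [].
  by apply: lee_nneseries => // n _; case: (nuP n).
- by rewrite setCT measure0.
- move=> x Px; rewrite potential_series; apply: eq_infty => A.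
  have p0 i : 0 <= potential G (nu i) x by apply: integral_ge0.
  have [N AN] : exists N, (A <= N%:R)%R.
    exists (Num.bound `|A|); apply: (le_trans (ler_norm _)).
    by apply: ltW; exact: archi_boundP.
  apply: (@le_trans _ _ N%:R%:E); first by rewrite lee_fin.
  apply: le_trans (nneseries_lim_ge N _); last by [].
  have -> : N%:R%:E = \sum_(0 <= i < N) 1 :> \bar R.
    by rewrite big_mkord sumEFin big_const_ord iter_addr_0.
  by apply: lee_sum => i _; have [_] := nuP i; apply.
Qed.

(** The competitors are the multiples of [mu] by [e / (1 + m)], where [m] is
    the mass of [mu]: their mass is at most [e]. *)
Lemma infinite_potential_c_star0 (P : set X)
    (mu : {measure set (borel X) -> \bar R}) :
  (forall c : {nonneg R}, radon (mscale c mu)) -> mu setT < +oo ->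
  (forall x, P x -> potential G mu x = +oo) -> c_star G P = 0.
Proof.
move=> rmu fmu pmu; apply/eqP; rewrite eq_le; apply/andP; split; last first.
  by apply: le_ereal_inf_tmp => _ [nu _ <-]; exact: measure_ge0.
apply/lee_addgt0Pr => e e0; rewrite add0e.
pose m := fine (mu setT).
have m0 : (0 <= m)%R by apply: fine_ge0.
have c0 : (0 < e / (1 + m))%R by rewrite divr_gt0// ltr_wpDr.
pose c := NngNum (ltW c0).
apply: (@le_trans _ _ (mscale c mu setT)).
  apply: ereal_inf_lbound; exists (mscale c mu) => //; split; first split.
  - by rewrite /= /mscale lte_mul_pinfty.
  - exact: rmu.
  - by rewrite setCT measure0.
  - by move=> x Px; rewrite potential_scale pmu// gt0_muley ?leey ?lte_fin.
have -> : mscale c mu setT = (e / (1 + m))%:E * mu setT by [].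
have -> : mu setT = m%:E by rewrite fineK// ge0_fin_numE.
rewrite -EFinM lee_fin [leLHS]mulrAC ler_pdivrMr; last by rewrite ltr_wpDr.
by apply: ler_wpM2l; [exact: ltW|rewrite lerDr].
Qed.

End potentials.

(** * Sweeping a measure onto a closed set *)

(** Taking the least possible index makes the choice measurable. *)
Lemma measurable_choice_index d (Y : measurableType d) (S : nat -> set Y) :
  (forall n, measurable (S n)) -> (forall z, exists n, S n z) ->
  exists N : Y -> nat, (forall z, S (N z) z) /\ measurable_fun [set: Y] N.
Proof.
move=> mS Sex.
have Sex' z : exists n, `[< S n z >].
  by have [n Snz] := Sex z; exists n; exact/asboolP.
pose N z := ex_minn (Sex' z).
exists N; split=> [z|_ B _]; first by rewrite /N; case: ex_minnP => n /asboolP.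
rewrite setTI.
have -> : N @^-1` B = \bigcup_(n in B) seqDU S n.
  rewrite eqEsubset; split=> [z Bz|z [n Bn [Snz nS]]] /=.
    exists (N z) => //; rewrite /N; case: ex_minnP => n /asboolP Snz nmin.
    split=> //; rewrite -bigcup_mkord => -[k /= kn /asboolP /nmin].
    by rewrite leqNgt kn.
  suff -> : N z = n by [].
  rewrite /N; case: ex_minnP => k /asboolP Skz kmin; apply/eqP.
  rewrite eqn_leq kmin/=; last exact/asboolP.
  rewrite leqNgt; apply/negP => kn; apply: nS.
  by rewrite -bigcup_mkord; exists k.
apply: bigcup_measurable => n _; apply: measurableD => //.
exact: bigsetU_measurable.
Qed.

Lemma dense_sequence (X : ptopologicalType) (K : set X) :
  @second_countable X -> K !=set0 ->
  exists a : nat -> X, (forall n, K (a n)) /\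
    forall x V, K x -> nbhs x V -> exists n, V (a n).
Proof.
move=> X_sc [x0 Kx0]; have [b [ob bV]] := base_sequence X_sc.
have /choice[a aP] : forall n, exists y, K y /\ (K `&` b n !=set0 -> b n y).
  move=> n; have [[y [Ky by_]]|nKb] := pselect (K `&` b n !=set0).
    by exists y.
  by exists x0.
exists a; split=> [n|x V Kx /bV[n [bx bnV]]]; first by case: (aP n).
by exists n; apply: bnV; have [_] := aP n; apply; exists x.
Qed.

Section sweeping.
Context {R : realType} {X : ptopologicalType} (G : X * X -> \bar R).
Hypotheses (G_borel : borel_kernel G) (G_gt0 : forall x y : X, 0 < G (x, y))
  (G_diag : singular_on_diagonal G) (X_sc : @second_countable X).

Let G_ge0 (x y : X) : 0 <= G (x, y). Proof. exact: ltW. Qed.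

Section quasi_metric.
Variables (U : set X) (C : R).
Hypothesis C0 : (0 < C)%R.
Hypothesis tri : forall x y z, U x -> U y -> U z ->
  mine (G (x, z)) (G (y, z)) <= C%:E * G (x, y).

Lemma triangle_le (c : R) (t : \bar R) (x y z : X) :
  (0 <= c)%R -> U x -> U y -> U z ->
  t <= c%:E * G (x, z) -> t <= c%:E * G (y, z) -> t <= (c * C)%:E * G (x, y).
Proof.
move=> c0 Ux Uy Uz tx ty; rewrite EFinM -muleA.
apply: (@le_trans _ _ (c%:E * mine (G (x, z)) (G (y, z)))).
  by rewrite /mine; case: ifP.
by apply: lee_wpmul2l; [rewrite lee_fin|exact: tri].
Qed.

(** Take [x] as the third point in the triangle property, using that
    [G (x, x)] is infinite. *)
Lemma quasi_symmetric (x y : X) :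
  U x -> U y -> G (y, x) <= C%:E * G (x, y).
Proof.
move=> Ux Uy; rewrite -[C]mul1r.
apply: (triangle_le (z := x)) => //; rewrite mul1e//.
by have [_ -> _] := G_diag x; rewrite leey.
Qed.

(** As [A] is closed, [G (z, _)] is bounded on [A]; by quasi-symmetry the
    values [G (a m, z)] then have a finite supremum, which is positive, so that
    half of it is exceeded by one of them. *)
Lemma near_maximizer (A : set X) (a : nat -> X) (z : X) :
  closed A -> (forall n, U (a n) /\ A (a n)) -> U z -> ~ A z ->
  exists n, forall m, G (a m, z) <= 2%:E * G (a n, z).
Proof.
move=> cA aUA Uz nAz.
have [_ _ /(_ (~` A)) []] := G_diag z.
  by apply: open_nbhs_nbhs; split=> //; exact: closed_openC.
move=> M GM.
pose s := ereal_sup [set G (a m, z) | m in [set: nat]].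
have les m : G (a m, z) <= s by apply: ereal_sup_ubound; exists m.
have s0 : 0 < s by apply: lt_le_trans (les 0%N).
have sM : s <= (C * M)%:E.
  apply: ge_ereal_sup => _ [m _ <-]; have [Um Am] := aUA m.
  apply: le_trans (quasi_symmetric Uz Um) _.
  by rewrite EFinM lee_pmul2l ?lte_fin//; apply: GM; apply.
have sfin : s \is a fin_num.
  by rewrite ge0_fin_numE ?(ltW s0)//; apply: le_lt_trans sM _; rewrite ltry.
have : (fine s / 2)%:E < s.
  rewrite -{2}(fineK sfin) lte_fin ltr_pdivrMr// ltr_pMr ?ltr1n//.
  by rewrite fine_gt0// s0 ltey_eq sfin.
move=> /ereal_sup_gt[_ [n _ <-] /ltW sn]; exists n => m.
apply: le_trans (les m) _; rewrite -(fineK sfin).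
have -> : fine s = (2 * (fine s / 2))%R by rewrite mulrC divfK.
by rewrite EFinM lee_pmul2l ?lte_fin.
Qed.

(** Choose [a m] so close to [x] that [G (x, a m)] is at least [G (x, z)]. The
    triangle property bounds [G (x, z)] by a multiple of [G (a m, z)], hence of
    [G (a n, z)]; used again with the third point [z], it bounds [G (x, z)] by a
    multiple of [G (x, a n)]. *)
Lemma near_maximizer_dominates (A : set X) (a : nat -> X) (x z : X) (n : nat) :
  closed A -> (forall n, U (a n)) ->
  (forall V, nbhs x V -> exists n, V (a n)) ->
  U x -> A x -> U z -> ~ A z ->
  (forall m, G (a m, z) <= 2%:E * G (a n, z)) ->
  G (x, z) <= ((1 + C * C * 2) * C)%:E * G (x, a n).
Proof.
move=> cA aU ax Ux Ax Uz nAz nmax.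
have C_ge0 := ltW C0.
have Gxz : G (x, z) \is a fin_num.
  rewrite ge0_fin_numE//; have [_ _ /(_ (~` A)) []] := G_diag z.
    by apply: open_nbhs_nbhs; split=> //; exact: closed_openC.
  move=> M GM; apply: le_lt_trans (quasi_symmetric Uz Ux) _.
  by rewrite lte_mul_pinfty//; apply: le_lt_trans (GM x _) (ltry _); apply.
have [m xm] : exists m, G (x, z) <= G (x, a m).
  apply: (ax [set y | G (x, z) <= G (x, y)]); rewrite dnbhsE; split; last first.
    by move=> _ /= ->; have [_ -> _] := G_diag x; rewrite leey.
  have [+ _ _] := G_diag x; rewrite -(fineK Gxz) => /cvgeyPge; exact.
have zx : G (x, z) <= C%:E * G (z, x) by exact: quasi_symmetric Uz Ux.
have mx : G (x, z) <= C%:E * G (a m, x).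
  by apply: le_trans xm _; exact: quasi_symmetric (aU m) Ux.
have mz := triangle_le C_ge0 (aU m) Uz Ux mx zx.
have nz : G (x, z) <= (C * C * 2)%:E * G (a n, z).
  apply: le_trans mz _; rewrite [X in _ <= X * _]EFinM -muleA.
  by apply: lee_wpmul2l => //; rewrite lee_fin mulr_ge0.
have c0 : (0 <= C * C * 2)%R by rewrite !mulr_ge0.
apply: (triangle_le (z := z)) => //.
- by rewrite addr_ge0.
- by rewrite -{1}[G (x, z)]mul1e; apply: lee_wpmul2r => //; rewrite lee_fin lerDl.
- by apply: le_trans nz _; apply: lee_wpmul2r => //; rewrite lee_fin lerDr.
Qed.

End quasi_metric.

(** [T] fixes the points of [A] in [U] and sends any other point [z] of [U] to
    a near maximizer of [G (_, z)] in a dense sequence of points of [A] in [U];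
    restricting the candidates to a sequence allows a measurable choice. *)
Lemma sweeping_map (U A : set X) :
  open U -> triangle_property_on G U -> closed A -> A `&` U !=set0 ->
  exists (T : borel X -> borel X) (c : R), [/\ measurable_fun [set: borel X] T,
    forall z, (A `&` U) (T z), (0 <= c)%R &
    forall x z, A x -> U x -> U z -> G (x, z) <= c%:E * G (x, T z)].
Proof.
move=> oU [C [C0 tri]] cA /(dense_sequence X_sc)[a [aK aV]].
have mA := closed_borel cA; have mU := open_borel oU.
have aU n : U (a n) by case: (aK n).
(* points of [A] and points outside [U] impose no condition on the index *)
pose S n : set (borel X) :=
  ~` (U `\` A) `|` \bigcap_m [set z | G (a m, z) <= 2%:E * G (a n, z)].
have mS n : measurable (S n).
  apply: measurableU; first by apply: measurableC; exact: measurableD.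
  apply: bigcapT_measurable => m; rewrite -[X in measurable X]setTI.
  apply: measurable_lee => //; first exact: measurable_section.
  by apply: measurable_funeM; exact: measurable_section.
have Sex z : exists n, S n z.
  have [UAz|nUAz] := pselect ((U `\` A) z); last by exists 0%N; left.
  have [|n nmax] := near_maximizer C0 tri cA _ UAz.1 UAz.2 (a := a).
    by move=> n; case: (aK n).
  by exists n; right=> m _; exact: nmax.
have [N [SN mN]] := measurable_choice_index mS Sex.
pose K : set (borel X) := A `&` U.
have mK : measurable K by exact: measurableI.
pose T z := if z \in K then z else a (N z).
(* the first 1 serves the points that [T] fixes *)
exists T, (1 + (1 + C * C * 2) * C)%R.
have c0 : (0 <= (1 + C * C * 2) * C)%R.
  by rewrite !(mulr_ge0, addr_ge0)// ltW.
split.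
- move=> _ B mB; rewrite setTI.
  have -> : T @^-1` B = (K `&` B) `|` (~` K `&` (N @^-1` (a @^-1` B))).
    rewrite /T eqEsubset; split=> z /=.
      case: ifPn => [/set_mem Kz Bz|/negP nKz Baz]; [by left|right].
      by split=> // /mem_set.
    by move=> [[/mem_set -> //]|[nKz Baz]]; rewrite memNset.
  apply: measurableU; first exact: measurableI.
  apply: measurableI; first exact: measurableC.
  by rewrite -[X in measurable X]setTI; exact: mN.
- by move=> z; rewrite /T; case: ifPn => [/set_mem|_].
- by rewrite addr_ge0.
- move=> x z Ax Ux Uz; rewrite /T; case: ifPn => [_|/negP nKz].
    by rewrite -{1}[G (x, z)]mul1e; apply: lee_wpmul2r => //; rewrite lee_fin lerDl.
  have nAz : ~ A z by move=> Az; apply: nKz; apply/mem_set.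
  have nmax m : G (a m, z) <= 2%:E * G (a (N z), z).
    by case: (SN z) => [[]//|]; exact.
  apply: le_trans (near_maximizer_dominates C0 tri cA aU _ Ux Ax Uz nAz nmax) _.
    by move=> V; apply: aV.
  by apply: lee_wpmul2r => //; rewrite lee_fin lerDr.
Qed.

(** The measure sought is the image of the given one under [sweeping_map].
    For [x] in [A] and [U], only [U] matters for the infinite potential at [x],
    as [G (x, _)] is bounded outside [U], and on [U] the map loses at most a
    constant factor. *)
Lemma infinite_potential_sweep (P U A : set X) :
  open U -> triangle_property_on G U -> closed A -> A `<=` P ->
  infinite_potential_on G setT (A `&` U) ->
  infinite_potential_on G P (A `&` U).
Proof.
move=> oU tU cA AP [nu [nu_fin _ nuK]].
have [K0|/set0P/negP/negPn/eqP K0] := pselect (A `&` U !=set0); last first.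
  by exists mzero; rewrite K0; split; rewrite /mzero/= ?ltry.
have [T [c [mT TK c0 GT]]] := sweeping_map oU tU cA K0.
have [mu muE] : exists mu : {measure set (borel X) -> \bar R},
    mu = pushforward nu T :> (set (borel X) -> \bar R).
  by unshelve refine (ex_intro _ _ (erefl (pushforward nu T))); exact: mT.
exists mu; rewrite muE; split.
- by [].
- rewrite /pushforward (_ : T @^-1` _ = set0) ?measure0//.
  by rewrite -subset0 => z /=; have [/AP + _] := TK z.
- move=> x [Ax Ux].
  have mU := open_borel oU.
  have mGT : measurable_fun [set: borel X] (fun z => G (x, T z)).
    exact: (measurableT_comp (measurable_section G_borel x) mT).
  have -> : potential G mu x = \int[nu]_z G (x, T z).
    rewrite /potential muE ge0_integral_pushforward//.
    exact: measurable_section.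
  have [_ _ /(_ U (open_nbhs_nbhs (conj oU Ux)))[M GM]] := G_diag x.
  have out_fin : \int[nu]_(z in ~` U) G (x, z) < +oo.
    apply: (@le_lt_trans _ _ (\int[nu]_(z in ~` U) cst M%:E z)).
      apply: ge0_le_integral => //; first exact: measurableC.
      exact: (measurable_funS measurableT _ (measurable_section G_borel x)).
    rewrite integral_cst; last exact: measurableC.
    have nuU : nu (~` U) \is a fin_num.
      rewrite ge0_fin_numE//; apply: le_lt_trans nu_fin.
      by apply: le_measure; rewrite ?inE//; exact: measurableC.
    by rewrite -(fineK nuU) -EFinM ltry.
  have in_infty : \int[nu]_(z in U) G (x, z) = +oo.
    have := nuK x (conj Ax Ux).
    rewrite /potential -(setUv U) ge0_integral_setU//; last 3 first.
    + exact: measurableC.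
    + by rewrite setUv; exact: measurable_section.
    + by rewrite disj_set2E setICr.
    move=> sumy; apply/eqP; rewrite -leye_eq leNgt; apply/negP => in_fin.
    by have := lte_add_pinfty in_fin out_fin; rewrite sumy ltxx.
  have : \int[nu]_(z in U) G (x, z) <= c%:E * \int[nu]_z G (x, T z).
    apply: (@le_trans _ _ (\int[nu]_(z in U) (c%:E * G (x, T z)))).
      apply: ge0_le_integral => //.
      + exact: (measurable_funS measurableT _ (measurable_section G_borel x)).
      + exact: measurable_funeM (measurable_funS measurableT _ mGT).
      + by move=> z; exact: GT.
    rewrite ge0_integralZl//; last exact: (measurable_funS measurableT _ mGT).
    by apply: lee_wpmul2l => //; exact: ge0_subset_integral.
  rewrite in_infty leye_eq => /eqP cI; apply/eqP.
  rewrite -leye_eq leNgt; apply/negP => I_fin.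
  have cE : 0 <= c%:E by rewrite lee_fin.
  by have := lte_mul_pinfty cE isT I_fin; rewrite cI ltxx.
Qed.

(** [P] is covered by the countably many intersections of some [A m] with a
    basic open set on which the triangle property holds. *)
Lemma infinite_potential_restrict (P : set X) (A : nat -> set X) :
  local_triangle_property G -> (forall m, closed (A m)) -> P = \bigcup_m A m ->
  infinite_potential_on G setT P -> infinite_potential_on G P P.
Proof.
move=> G_tri cA PA [nu [nu_fin nu0 nuP]].
have [b [ob bV]] := base_sequence X_sc.
pose Q m n := A m `&` [set x | triangle_property_on G (b n) /\ b n x].
have PQ : P = \bigcup_m \bigcup_n Q m n.
  rewrite PA; apply: eq_bigcupr => m _.
  rewrite eqEsubset; split=> [x Ax|x [n _ []]//].
  have [U [oU Ux [C [C0 tri]]]] := G_tri x.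
  have [n [bx bU]] := bV x U (open_nbhs_nbhs (conj oU Ux)).
  exists n => //; split=> //; split=> //; exists C; split=> // u v w bu bv bw.
  by apply: tri; exact: bU.
rewrite {2}PQ; apply: (infinite_potential_on_bigcup G_borel G_gt0) => m.
apply: (infinite_potential_on_bigcup G_borel G_gt0) => n.
have AP : A m `<=` P by move=> x Ax; rewrite PA; exists m.
have [tb|ntb] := pselect (triangle_property_on G (b n)); last first.
  exists mzero; split; rewrite /mzero/= ?ltry//.
  by move=> x [_ [/ntb]].
have -> : Q m n = A m `&` b n.
  by rewrite eqEsubset; split=> x [Ax]; [move=> [_ bx]|].
apply: infinite_potential_sweep => //; exists nu; split=> //.
by move=> x [/AP Px _]; exact: nuP.
Qed.

End sweeping.

(** * Vanishing of [c_star] and infinite potentials *)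

Theorem theorem1p1 (R : realType) (X : ptopologicalType)
    (X_lc : locally_compact [set: X]) (X_hausdorff : hausdorff_space X)
    (X_sc : @second_countable X)
    (G : X * X -> \bar R) (G_borel : borel_kernel G)
    (G_gt0 : forall x y : X, 0 < G (x, y))
    (G_diag : singular_on_diagonal G)
    (G_triangle : local_triangle_property G)
    (P : set X) (A : nat -> set X)
    (A_closed : forall m : nat, closed (A m))
    (P_Fsigma : P = \bigcup_m A m) :
  c_star G P = 0 <->
  exists mu : {measure set (borel X) -> \bar R},
    finite_radon_on P mu /\ forall x : X, P x -> potential G mu x = +oo.
Proof.
have radonP := @finite_borel_radon R X X_lc X_hausdorff X_sc.
split=> [cP|[mu [[mu_fin _ _] muP]]].
  have nuP := c_star0_infinite_potential G_borel G_gt0 cP.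
  have [mu [mu_fin mu0 muP]] := infinite_potential_restrict G_borel G_gt0 G_diag
    X_sc G_triangle A_closed P_Fsigma nuP.
  by exists mu; split=> //; split=> //; exact: radonP.
apply: (infinite_potential_c_star0 G_borel G_gt0 _ mu_fin muP) => c.
by apply: radonP; apply: (@lte_mul_pinfty _ c%:num%:E (mu setT)).
Qed.
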